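(* Let $N=1$ and consider the lattice Boltzmann scheme with linear equilibria $\boldsymbol m^{\mathrm{eq}}=\boldsymbol\epsilon\,m_1$, $\boldsymbol\epsilon\in\mathbb{R}^q$, rewritten as $\boldsymbol m^{n+1}=(\boldsymbol A+\boldsymbol B\boldsymbol\epsilon\otimes\boldsymbol e_1)\boldsymbol m^n$. This lattice Boltzmann scheme is stable in the von Neumann sense (for lattice Boltzmann schemes) if and only if its corresponding multi-step Finite Difference scheme on the conserved moment $m_1$, namely $\sum_{k=0}^{q}\varphi_{q-k}\,m_1^{n+1-k}=0$ with $$\varphi_q=1,\qquad \varphi_k=\gamma_k-\left(\sum_{\ell=0}^{q-1-k}\gamma_{k+1+\ell}\,\boldsymbol A^{\ell}\boldsymbol B\,\boldsymbol\epsilon\otimes\boldsymbol e_1\right)_{11}\quad (0\le k\le q-1),$$ where $\chi_{\boldsymbol A}=\sum_{k=0}^q\gamma_kX^k$, is stable in the von Neumann sense (for Finite Difference schemes).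
   Context: Lattice and operators: $d\in\{1,2,3\}$, $\Delta x>0$, $\mathcal{L}=\Delta x\,\mathbb{Z}^d$. For $\boldsymbol z\in\mathbb{Z}^d$ the shift $T^{\boldsymbol z}$ acts on functions $f:\mathcal{L}\to\mathbb{R}$ by $(T^{\boldsymbol z}f)(\boldsymbol x)=f(\boldsymbol x-\boldsymbol z\Delta x)$. $\mathcal{D}$ denotes the commutative ring of Finite Difference operators, i.e. finite real linear combinations of shifts, with composition $T^{\boldsymbol z}\circ T^{\boldsymbol w}=T^{\boldsymbol z+\boldsymbol w}$ as product (the group ring $\mathbb{R}[\mathbb{Z}^d]$). Lattice Boltzmann scheme with one conserved moment ($N=1$): $q\ge 2$, velocities $\boldsymbol c_1,\dots,\boldsymbol c_q\in\mathbb{Z}^d$, an invertible moment matrix $\boldsymbol M\in\mathrm{GL}_q(\mathbb{R})$, a relaxation matrix $\boldsymbol S=\mathrm{diag}(0,s_2,\dots,s_q)$ with $s_i\in\,]0,2]$. Put $\boldsymbol T=\boldsymbol M\,\mathrm{diag}(T^{\boldsymbol c_1},\dots,T^{\boldsymbol c_q})\boldsymbol M^{-1}$, $\boldsymbol A=\boldsymbol T(\boldsymbol I-\boldsymbol S)$, $\boldsymbol B=\boldsymbol T\boldsymbol S$ in $\mathcal{M}_q(\mathcal{D})$. The moments $\boldsymbol m^n=(m_1^n,\dots,m_q^n)^{\mathsf T}$, $m^n_j:\mathcal{L}\to\mathbb{R}$, evolve by $\boldsymbol m^{n+1}=\boldsymbol A\boldsymbol m^n+\boldsymbol B\,\boldsymbol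 m^{\mathrm{eq}}|^n$, where $\boldsymbol m^{\mathrm{eq}}|^n$ is the vector of equilibria evaluated at the conserved moment $m_1^n$. Notation: $\boldsymbol e_1$ is the first canonical basis vector; $\boldsymbol u\otimes\boldsymbol v=\boldsymbol u\boldsymbol v^{\mathsf T}$, and $\boldsymbol B\boldsymbol\epsilon\otimes\boldsymbol e_1=(\boldsymbol B\boldsymbol\epsilon)\boldsymbol e_1^{\mathsf T}$; $\chi_{\boldsymbol C}=(-1)^r\det(\boldsymbol C-X\boldsymbol I)$ is the characteristic polynomial of an $r\times r$ matrix. Fourier representation: for $\boldsymbol\xi\in[-\pi/\Delta x,\pi/\Delta x]^d$, the operator $\mathsf D=\sum_{\boldsymbol z}\alpha_{\boldsymbol z}T^{\boldsymbol z}\in\mathcal{D}$ is represented by $\hat{\mathsf D}(\boldsymbol\xi)=\sum_{\boldsymbol z}\alpha_{\boldsymbol z}e^{-\imath\Delta x\,\boldsymbol z\cdot\boldsymbol\xi}\in\mathbb{C}$, and matrices over $\mathcal{D}$ are represented entrywise. Von Neumann stability of a Finite Difference scheme $\sum_{k=0}^q\varphi_{q-k}u^{n+1-k}=0$, $\varphi_k\in\mathcal{D}$: for every $\hat g:[-\pi/\Delta x,\pi/\Delta x]^d\to\mathbb{C}$ such that $\hat\Phi(\hat g(\boldsymbol\xi))=\sum_{k=0}^q\hat\varphi_k(\boldsymbol\xi)\hat g(\boldsymbol\xi)^k=0$ for all $\boldsymbol\xi$, one has (1) $|\hat g(\boldsymbol\xi)|\le1$ for every $\boldsymbol\xi$;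 (2) if $|\hat g(\boldsymbol\xi)|=1$ for some $\boldsymbol\xi$, then $\hat g(\boldsymbol\xi)$ is a simple root (of the polynomial $\sum_k\hat\varphi_k(\boldsymbol\xi)X^k$). Von Neumann stability of the lattice Boltzmann scheme $\boldsymbol m^{n+1}=(\boldsymbol A+\boldsymbol B\boldsymbol\epsilon\otimes\boldsymbol e_1)\boldsymbol m^n$: for every $\boldsymbol\xi\in[-\pi/\Delta x,\pi/\Delta x]^d$, every eigenvalue $\hat g$ of $\hat{\boldsymbol A}(\boldsymbol\xi)+\hat{\boldsymbol B}(\boldsymbol\xi)\boldsymbol\epsilon\otimes\boldsymbol e_1$ satisfies (1) $|\hat g|\le1$; (2) if $|\hat g|=1$, then $\hat g$ is a simple eigenvalue (algebraic multiplicity one) of this matrix. *)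

(* Defs.v *)
From HB Require Import structures.
From mathcomp Require Import all_boot all_order all_algebra finmap.
From mathcomp Require Import reals trigo.
From mathcomp Require Import complex.
From mathcomp.multinomials Require Import monalg.

Set Implicit Arguments.
Unset Strict Implicit.
Unset Printing Implicit Defensive.

Import Order.TTheory GRing.Theory Num.Theory.
Local Open Scope fset_scope.
Local Open Scope ring_scope.

(* The ring of Finite Difference operators, as the group ring R[Z^d]:
   [D] stands for the sum over z of D@_z T^z, where T^z sends a lattice function
   f to x |-> f (x - z dx).  The ring structure that multinomials puts on
   {malg R[K]} requires a monoid K without nontrivial units, hence excludes
   K = Z^d; the convolution product is therefore defined here. *)
Definition fdop (R : comNzRingType) (d : nat) := {malg R['rV[int]_d]}.

Section FDopRing.
Variables (R : comNzRingType) (d : nat).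
Implicit Types (D E F : fdop R d) (z w : 'rV[int]_d).

HB.instance Definition _ := GRing.Lmodule.on (fdop R d).

Definition shift z : fdop R d := << z >>.

Definition fdconst (a : R) : fdop R d := << a *g 0 >>.

Definition fdmul D E : fdop R d :=
  \sum_(z <- msupp D) \sum_(w <- msupp E) << D@_z * E@_w *g z + w >>.

Lemma fdmulw (d1 d2 : {fset 'rV[int]_d}) D E :
  msupp D `<=` d1 -> msupp E `<=` d2 ->
  fdmul D E = \sum_(z <- d1) \sum_(w <- d2) << D@_z * E@_w *g z + w >>.
Proof.
move=> le_d1 le_d2; rewrite /fdmul (big_fset_incl _ le_d1) /=.
  apply/eq_bigr=> z _; apply/big_fset_incl => // w _ /mcoeff_outdom ->.
  by rewrite mulr0 monalgU0.
move=> z _ /mcoeff_outdom Dz.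
by rewrite big1 => // w _; rewrite Dz mul0r monalgU0.
Qed.

Lemma fdmulC : commutative fdmul.
Proof.
move=> D E; rewrite /fdmul exchange_big; apply/eq_bigr=> z _.
by apply/eq_bigr=> w _; rewrite mulrC addrC.
Qed.

Lemma fdmulUg a z E :
  fdmul << a *g z >> E = \sum_(w <- msupp E) << a * E@_w *g z + w >>.
Proof.
rewrite (fdmulw msuppU_le (fsubset_refl _)) big_seq_fset1.
by apply/eq_bigr => w _; rewrite mcoeffUU.
Qed.

Lemma fdmulUU a b z w :
  fdmul << a *g z >> << b *g w >> = << a * b *g z + w >>.
Proof. by rewrite (fdmulw msuppU_le msuppU_le) !big_seq_fset1 !mcoeffUU. Qed.

Lemma fdmul1g : left_id (fdconst 1) fdmul.
Proof.
move=> D; rewrite fdmulUg [RHS]monalgE.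
by apply/eq_bigr=> z _; rewrite mul1r add0r.
Qed.

Lemma fdmulDl : left_distributive fdmul +%R.
Proof.
move=> D E F.
rewrite (fdmulw (msuppD_le D E) (fsubset_refl _)).
rewrite (fdmulw (fsubsetUl (msupp D) (msupp E)) (fsubset_refl _)).
rewrite (fdmulw (fsubsetUr (msupp D) (msupp E)) (fsubset_refl _)).
rewrite -big_split /=; apply/eq_bigr=> z _.
rewrite -big_split /=; apply/eq_bigr=> w _.
by rewrite mcoeffD mulrDl monalgUD.
Qed.

Lemma fdmul0g : left_zero 0 fdmul.
Proof. by move=> D; rewrite /fdmul msupp0 big_seq_fset0. Qed.

Lemma fdmulDr : right_distributive fdmul +%R.
Proof. by move=> D E F; rewrite fdmulC fdmulDl !(fdmulC D). Qed.

Lemma fdmulg0 : right_zero 0 fdmul.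
Proof. by move=> D; rewrite fdmulC fdmul0g. Qed.

Lemma fdmulEl D E : fdmul D E = \sum_(z <- msupp D) fdmul << D@_z *g z >> E.
Proof. by apply/eq_bigr=> z _; rewrite fdmulUg. Qed.

Lemma fdmulEr D E : fdmul D E = \sum_(w <- msupp E) fdmul D << E@_w *g w >>.
Proof.
by rewrite fdmulC fdmulEl; apply/eq_bigr=> w _; rewrite fdmulC.
Qed.

Lemma fdmulA : associative fdmul.
Proof.
move=> D E F.
rewrite [fdmul D E]fdmulEl.
rewrite [RHS](big_morph (fdmul^~ _) (fun _ _ => fdmulDl _ _ _) (fdmul0g _)).
rewrite fdmulEl; apply/eq_bigr=> z _; rewrite [fdmul E F]fdmulEl.
rewrite [LHS](big_morph (fdmul _) (fun _ _ => fdmulDr _ _ _) (fdmulg0 _)).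
rewrite [fdmul _ E]fdmulEr.
rewrite [RHS](big_morph (fdmul^~ _) (fun _ _ => fdmulDl _ _ _) (fdmul0g _)).
apply/eq_bigr=> w _; rewrite [fdmul << E@_w *g w >> F]fdmulEr.
rewrite [LHS](big_morph (fdmul _) (fun _ _ => fdmulDr _ _ _) (fdmulg0 _)).
by rewrite [RHS]fdmulEr; apply/eq_bigr=> u _; rewrite !fdmulUU mulrA addrA.
Qed.

Lemma fdone_neq0 : fdconst 1 != 0.
Proof.
by apply/eqP/malgP=> /(_ 0) /eqP; rewrite mcoeffUU mcoeff0 oner_eq0.
Qed.

HB.instance Definition _ := GRing.Zmodule_isComNzRing.Build (fdop R d)
  fdmulA fdmulC fdmul1g fdmulDl fdone_neq0.

Lemma shiftD z w : shift (z + w) = shift z * shift w.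
Proof. by rewrite [RHS]fdmulUU mulr1. Qed.

End FDopRing.

Definition expi (R : realType) (t : R) : R[i] := Complex (cos t) (sin t).

Section Fourier.
Variables (R : realType) (d : nat) (dx : R).

Definition frequency (xi : 'rV[R]_d) : Prop :=
  forall j, - (pi / dx) <= xi 0 j <= pi / dx.

Definition fourier (xi : 'rV[R]_d) (D : fdop R d) : R[i] :=
  \sum_(z <- msupp D)
    (D@_z)%:C%C * expi (- (dx * \sum_(j < d) (z 0 j)%:~R * xi 0 j)).

End Fourier.

Section FiniteDifference.
Variables (R : realType) (d : nat) (dx : R) (q : nat).

(* Amplification polynomial of  sum_(k <= q) phi_(q-k) u^(n+1-k) = 0; only
   phi 0, ..., phi q matter. *)
Definition fd_amplification (phi : nat -> fdop R d) (xi : 'rV[R]_d) :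
    {poly R[i]} :=
  \sum_(k < q.+1) fourier dx xi (phi k) *: 'X^k.

(* Functions g on the frequency box are represented by functions on R^d of
   which only the values on the box are used; [mup x p] is the multiplicity of
   x as a root of p. *)
Definition fd_vN_stable (phi : nat -> fdop R d) : Prop :=
  forall g : 'rV[R]_d -> R[i],
    (forall xi, frequency dx xi -> (fd_amplification phi xi).[g xi] = 0) ->
    (forall xi, frequency dx xi -> `|g xi| <= 1) /\
    (forall xi, frequency dx xi -> `|g xi| = 1 ->
       mup (g xi) (fd_amplification phi xi) = 1%N).

End FiniteDifference.

(* In this section i1 stands for the (0-based) index of the conserved moment. *)
Section LatticeBoltzmann.
Variables (R : realType) (d q : nat) (i1 : 'I_q).

Definition unit_vec (K : nzRingType) : 'cV[K]_q := delta_mx i1 0.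

Definition tensor (K : nzRingType) (u v : 'cV[K]_q) : 'M[K]_q := u *m v^T.

Section Scheme.
Variables (c : 'I_q -> 'rV[int]_d) (M : 'M[R]_q) (s : 'rV[R]_q).

Definition lb_T : 'M[fdop R d]_q :=
  map_mx (@fdconst R d) M *m diag_mx (\row_j shift R (c j))
    *m map_mx (@fdconst R d) (invmx M).

Definition lb_A : 'M[fdop R d]_q :=
  lb_T *m (1%:M - map_mx (@fdconst R d) (diag_mx s)).

Definition lb_B : 'M[fdop R d]_q :=
  lb_T *m map_mx (@fdconst R d) (diag_mx s).

End Scheme.

Variables (A B : 'M[fdop R d]_q) (eps : 'cV[R]_q).

(* char_poly A is det (X I - A) = (-1)^q det (A - X I). *)
Definition fd_coef (k : nat) : fdop R d :=
  let gamma l := (char_poly A)`_l in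
  if k == q then 1 else
  gamma k -
    (\sum_(l < q - k)
       gamma (k + 1 + l)%N *:
         (A ^+ l *m tensor (B *m map_mx (@fdconst R d) eps) (unit_vec _)))
    i1 i1.

Definition lb_amplification (dx : R) (xi : 'rV[R]_d) : 'M[R[i]]_q :=
  map_mx (fourier dx xi) A +
    tensor (map_mx (fourier dx xi) B *m map_mx (fun a : R => a%:C%C) eps)
           (unit_vec _).

Definition lb_vN_stable (dx : R) : Prop :=
  forall xi, frequency dx xi ->
  forall g : R[i], eigenvalue (lb_amplification dx xi) g ->
    `|g| <= 1 /\
    (`|g| = 1 -> mup g (char_poly (lb_amplification dx xi)) = 1%N).

End LatticeBoltzmann.

(* Main.v *)
(* The amplification polynomial of the Finite Difference scheme at a frequency
   is the characteristic polynomial of the amplification matrix there.  Already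
   over the ring of Finite Difference operators, the adjugate of X I - A is the
   sum of the X^k gamma_(k+1+l) A^l, so the matrix determinant lemma gives
   det (X I - A - u v^T) = chi_A - v^T adj (X I - A) u, whose coefficients for
   u = B eps and v = e_1 are the phi_k; the Fourier representation is a ring
   morphism, hence commutes with characteristic polynomials. *)
Require Import Defs.
From HB Require Import structures.
From mathcomp Require Import all_boot all_order all_algebra finmap.
From mathcomp Require Import reals trigo.
From mathcomp Require Import complex.
From mathcomp.multinomials Require Import monalg.

Set Implicit Arguments.
Unset Strict Implicit.
Unset Printing Implicit Defensive.

Import Order.TTheory GRing.Theory Num.Theory.
Local Open Scope ring_scope.

(* The matrix [Q] plays the adjugate of [P]; asking for [b] regular rather than
   invertible covers monic polynomials over any commutative ring. *)
Lemma det_rank1_update (K : comNzRingType) (n : nat) (P Q : 'M[K]_n)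
    (u v : 'cV[K]_n) (b : K) :
  GRing.lreg b -> \det P = b -> P *m Q = b%:M ->
  \det (P - u *m v^T) = b - (v^T *m Q *m u) 0 0.
Proof.
move=> b_reg detP PQ; pose N := block_mx P u v^T (1%:M : 'M_1).
have detN : \det (P - u *m v^T) = \det N.
  have -> : N = block_mx (P - u *m v^T) u 0 1%:M *m block_mx 1%:M 0 v^T 1%:M.
    by rewrite mulmx_block !mulmx1 !mul1mx !mulmx0 !add0r subrK.
  by rewrite det_mulmx det_ublock det_lblock !det1 !mulr1.
(* By regularity it suffices to compare after multiplication by [b], the determinant of a column
   operation that clears the upper right block of [N] because [P *m Q] is scalar. *)
apply: b_reg; rewrite detN mulrC.
have : N *m block_mx 1%:M (- (Q *m u)) 0 b%:M =
       block_mx P 0 v^T (b%:M - v^T *m Q *m u).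
  rewrite mulmx_block !mulmx1 !mulmx0 !addr0 mul1mx !mulmxN !mulmxA PQ.
  by rewrite scalar_mxC addNr [X in block_mx _ _ _ X]addrC.
move=> /(congr1 determinant); rewrite det_mulmx det_ublock det_lblock det1.
by rewrite mul1r det_scalar expr1 detP det_mx11 !mxE eqxx mulr1n.
Qed.

Section CharPolyRank1.
Variables (K : comNzRingType) (n : nat) (A : 'M[K]_n).

(** This is the quotient of [char_poly A] by ['X^k], evaluated at [A]. With index [k.+1] it is the
    coefficient of ['X^k] in the adjugate of X I - A. *)
Definition char_poly_tail (k : nat) : 'M[K]_n :=
  \sum_(l < n.+1 - k) (char_poly A)`_(k + l) *: A ^+ l.

Lemma char_poly_tail_rec (k : nat) : (k <= n)%N ->
  char_poly_tail k = ((char_poly A)`_k)%:M + A *m char_poly_tail k.+1.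
Proof.
move=> le_kn; rewrite /char_poly_tail subSS subSn // big_ord_recl addn0.
rewrite expr0 -scalemx1 mulmx_sumr; congr (_ + _).
by apply: eq_bigr => l _; rewrite -scalemxAr addnS addSn exprS.
Qed.

Lemma char_poly_tail_size : char_poly_tail n.+1 = 0.
Proof. by rewrite /char_poly_tail subnn big_ord0. Qed.

Lemma char_poly_tail0 : char_poly_tail 0 = 0.
Proof.
(* Cayley-Hamilton is applied in nonzero size; in size 0 all matrices are equal. *)
rewrite /char_poly_tail subn0; move: A; case: n => [|n'] B; first exact: thinmx0.
rewrite -[RHS](Cayley_Hamilton B) -[X in horner_mx _ X]coefK poly_def.
rewrite size_char_poly linear_sum; apply: eq_bigr => l _.
by rewrite linearZ rmorphXn /= horner_mx_X.
Qed.

(** By the recursion on tails the product telescopes. The end terms vanish, at [n.+1] as an empty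
    sum and at 0 by Cayley-Hamilton, and only the terms of [char_poly A] remain. *)
Lemma char_poly_tail_resolvent :
  char_poly_mx A *m
    (\sum_(k < n) 'X^k *: map_mx polyC (char_poly_tail k.+1)) =
  (char_poly A)%:M.
Proof.
pose H k := map_mx polyC (char_poly_tail k).
(* A zero term at [k = n] is appended, so that the leading coefficient of [char_poly A] also appears
   in the telescoping. *)
have -> : \sum_(k < n) 'X^k *: map_mx polyC (char_poly_tail k.+1) =
          \sum_(0 <= k < n.+1) 'X^k *: H k.+1.
  rewrite big_mkord big_ord_recr /= /H char_poly_tail_size.
  by rewrite raddf0 scaler0 addr0.
have stepE k : (k < n.+1)%N -> char_poly_mx A *m ('X^k *: H k.+1) =
   ('X^(k.+1) *: H k.+1 - 'X^k *: H k) + (((char_poly A)`_k)%:P * 'X^k)%:M.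
  move=> lt_kn; rewrite -scalemxAr mulmxBl mul_scalar_mx scalerBr scalerA -exprSr.
  rewrite [H k]/H char_poly_tail_rec // map_mxD map_mxM map_scalar_mx scalerDr.
  by rewrite scale_scalar_mx mulrC opprD (addrC (- _)) addrA addrNK.
rewrite mulmx_sumr (eq_big_nat _ _ (F2 := fun k => ('X^(k.+1) *: H k.+1 -
  'X^k *: H k) + (((char_poly A)`_k)%:P * 'X^k)%:M)) //.
rewrite big_split /= (telescope_sumr (fun k => 'X^k *: H k)) //.
rewrite /H char_poly_tail_size char_poly_tail0.
rewrite !map_mx0 !scaler0 subrr add0r -raddf_sum big_mkord; congr _%:M.
rewrite -[RHS]coefK poly_def size_char_poly.
by apply: eq_bigr => k _; rewrite mul_polyC.
Qed.

Lemma char_poly_rank1_update (u v : 'cV[K]_n) :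
  char_poly (A + u *m v^T) = char_poly A -
    \poly_(k < n) (v^T *m char_poly_tail k.+1 *m u) 0 0.
Proof.
have -> : char_poly (A + u *m v^T) =
    \det (char_poly_mx A - map_mx polyC u *m (map_mx polyC v)^T).
  by rewrite /char_poly /char_poly_mx map_mxD map_mxM map_trmx opprD addrA.
rewrite (det_rank1_update _ _ (monic_lreg (char_poly_monic A)) erefl
  char_poly_tail_resolvent).
rewrite poly_def; congr (_ - _).
rewrite mulmx_sumr mulmx_suml summxE; apply: eq_bigr => k _.
by rewrite -scalemxAr -scalemxAl mxE map_trmx -!map_mxM mxE mulrC mul_polyC.
Qed.

End CharPolyRank1.

Section FourierMorphism.
Variables (R : realType) (d : nat) (dx : R) (xi : 'rV[R]_d).

Let wave (z : 'rV[int]_d) : R[i] :=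
  expi (- (dx * \sum_(j < d) (z 0 j)%:~R * xi 0 j)).

Lemma expiD (t u : R) : expi (t + u) = expi t * expi u.
Proof.
by apply/eqP; rewrite eq_complex /= cosD sinD [_ + cos t * _]addrC !eqxx.
Qed.

Lemma expi0 : expi (0 : R) = 1.
Proof. by rewrite /expi cos0 sin0. Qed.

Lemma waveD (z w : 'rV[int]_d) : wave (z + w) = wave z * wave w.
Proof.
rewrite /wave -expiD -opprD -mulrDr -big_split /=; congr (expi (- (_ * _))).
by apply: eq_bigr => j _; rewrite mxE intrD mulrDl.
Qed.

Lemma wave0 : wave 0 = 1.
Proof.
by rewrite /wave big1 => [|j _]; rewrite ?mulr0 ?oppr0 ?expi0 // mxE mul0r.
Qed.

Lemma fourierw (d1 : {fset 'rV[int]_d}) (D : fdop R d) :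
  (msupp D `<=` d1)%fset ->
  fourier dx xi D = \sum_(z <- d1) (D@_z)%:C%C * wave z.
Proof.
move=> le_d1; apply: big_fset_incl => // z _ /mcoeff_outdom ->.
by rewrite rmorph0 mul0r.
Qed.

Lemma fourierU (a : R) (z : 'rV[int]_d) :
  fourier dx xi << a *g z >> = a%:C%C * wave z.
Proof. by rewrite (fourierw msuppU_le) big_seq_fset1 mcoeffUU. Qed.

Lemma fourier_const (a : R) : fourier dx xi (fdconst d a) = a%:C%C.
Proof. by rewrite fourierU wave0 mulr1. Qed.

Lemma fourier_is_zmod_morphism : zmod_morphism (@fourier R d dx xi).
Proof.
move=> D E; rewrite (fourierw (msuppB_le D E)).
rewrite (fourierw (fsubsetUl (msupp D) (msupp E))).
rewrite (fourierw (fsubsetUr (msupp D) (msupp E))) -sumrB.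
by apply: eq_bigr => z _; rewrite mcoeffB rmorphB mulrBl.
Qed.

HB.instance Definition _ :=
  GRing.isZmodMorphism.Build (fdop R d) R[i] (@fourier R d dx xi)
    fourier_is_zmod_morphism.

(** The map [wave] is a character of the group Z^d, so the transform of a convolution splits into a
    product of two sums. *)
Lemma fourier_is_monoid_morphism : monoid_morphism (@fourier R d dx xi).
Proof.
split=> [|D E]; first exact: fourier_const.
rewrite [D * E]/(fdmul D E) /fdmul raddf_sum /fourier big_distrlr /=.
apply: eq_bigr => z _; rewrite -/(fourier _ _ _) raddf_sum.
by apply: eq_bigr => w _ /=; rewrite fourierU waveD rmorphM mulrACA.
Qed.

HB.instance Definition _ :=
  GRing.isMonoidMorphism.Build (fdop R d) R[i] (@fourier R d dx xi)
    fourier_is_monoid_morphism.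

End FourierMorphism.

Section AmplificationPolynomial.
Variables (R : realType) (d q : nat) (i1 : 'I_q).
Variables (A B : 'M[fdop R d]_q) (eps : 'cV[R]_q).

Let C := tensor (B *m map_mx (@fdconst R d) eps) (unit_vec i1 _).

Lemma fd_coefE (k : nat) : (k <= q)%N ->
  fd_coef i1 A B eps k = (char_poly (A + C))`_k.
Proof.
rewrite leq_eqVlt /fd_coef; case: eqP => [-> _ | _ /= lt_kq].
  by have /monicP := char_poly_monic (A + C); rewrite lead_coefE size_char_poly.
rewrite /C /tensor char_poly_rank1_update coefB coef_poly lt_kq.
congr (_ - _); rewrite /char_poly_tail subSS mulmx_sumr mulmx_suml.
rewrite !summxE; apply: eq_bigr => l _.
rewrite -scalemxAr -scalemxAl mxE [RHS]mxE addn1; congr (_ * _).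
(* Multiplying by the transposed unit vector selects row [i1] on the left and fills column [i1] on
   the right; both sides are entry [i1] of [A ^+ l *m B] applied to [eps]. *)
rewrite /unit_vec trmx_delta -[in RHS]mulmxA -rowE [RHS]mxE mulmxA.
by rewrite [LHS]mxE big_ord1 [delta_mx _ _ _ _]mxE !eqxx mulr1.
Qed.

Lemma lb_amplificationE (dx : R) (xi : 'rV[R]_d) :
  lb_amplification i1 A B eps dx xi = map_mx (fourier dx xi) (A + C).
Proof.
rewrite /lb_amplification /C /tensor map_mxD !map_mxM -map_trmx /unit_vec map_delta_mx -map_mx_comp.
congr (_ + _ *m _ *m _).
by apply/matrixP => i j; rewrite !mxE /= fourier_const.
Qed.

Lemma fd_amplificationE (dx : R) (xi : 'rV[R]_d) :
  fd_amplification dx q (fd_coef i1 A B eps) xi =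
  char_poly (lb_amplification i1 A B eps dx xi).
Proof.
rewrite lb_amplificationE -map_char_poly -[RHS]coefK poly_def.
rewrite map_char_poly size_char_poly -map_char_poly.
by apply: eq_bigr => k _; rewrite coef_map /= fd_coefE // -ltnS.
Qed.

End AmplificationPolynomial.

Theorem corollary13 (R : realType) (d : nat) (dx : R) (q : nat)
  (hd : (1 <= d <= 3)%N) (hdx : 0 < dx) (hq : (2 <= q)%N)
  (c : 'I_q -> 'rV[int]_d) (M : 'M[R]_q) (s : 'rV[R]_q) (eps : 'cV[R]_q)
  (i1 : 'I_q) (hi1 : i1 = 0%N :> nat)
  (hM : M \in unitmx)
  (hs1 : s 0 i1 = 0) (hs : forall i : 'I_q, i != i1 -> 0 < s 0 i <= 2) :
  lb_vN_stable i1 (lb_A c M s) (lb_B c M s) eps dx <->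
  fd_vN_stable dx q (fd_coef i1 (lb_A c M s) (lb_B c M s) eps).
Proof.
set A := lb_A c M s; set B := lb_B c M s.
split=> [lb_stable g g_root | fd_stable xi xi_freq g].
  have stable xi : frequency dx xi -> `|g xi| <= 1 /\ (`|g xi| = 1 ->
      mup (g xi) (fd_amplification dx q (fd_coef i1 A B eps) xi) = 1%N).
    move=> xi_freq; rewrite fd_amplificationE; apply: lb_stable => //.
    by rewrite eigenvalue_root_char -fd_amplificationE; apply/rootP/g_root.
  by split=> xi /stable [].
rewrite eigenvalue_root_char => g_root.
(* A competitor in [fd_stable] needs a root at every frequency, not only at [xi]. One exists because
   the polynomial has degree [q > 0] and [R[i]] is algebraically closed. *)
have root_ex zeta : exists x : R[i],
    root (fd_amplification dx q (fd_coef i1 A B eps) zeta) x.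
  apply/closed_rootP; rewrite fd_amplificationE size_char_poly eqSS.
  by rewrite -lt0n ltnW.
(* The eigenvalue at [xi] is one value of a global selection of roots. *)
pose h zeta := if zeta == xi then g else xchoose (root_ex zeta).
have h_xi : h xi = g by rewrite /h eqxx.
case: (fd_stable h) => [zeta _ | h_le1 h_simple].
  apply/rootP; rewrite /h; case: eqP => [->|_]; last exact: xchooseP.
  by rewrite fd_amplificationE.
rewrite -h_xi -fd_amplificationE; split; [exact: h_le1 | exact: h_simple].
Qed.
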